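(* Let $S$ be a set or multiset of positive integers. Then $\mathsf{S}(z,q)=\prod_{\ell\in S}(1+zq^\ell)(1+z^{-1}q^\ell)\in\mathscr{T}_{z,q}^2$. In particular, $d_S(m,n)>d_S(m+2,n)$ for all integers $m,n\ge0$ such that $d_S(m,n)\ne0$, where $\mathsf{S}(z,q)=\sum_{n\ge0}\sum_{m\in\mathbb{Z}}d_S(m,n)z^mq^n$.
   Context: Each element of $S$ has finite multiplicity, so the product is a power series in $q$ whose coefficients are Laurent polynomials in $z$. $\mathscr{T}_z^2$ is the set of Laurent polynomials $\sum_ic_iz^i$ with real $c_i\ge0$, $c_{-i}=c_i$, and for $r\in\{0,1\}$, $\ell\ge0$: $c_{r+2\ell}\ge c_{r+2(\ell+1)}$, with strict inequality whenever $c_{r+2\ell}>0$. A series $\sum_nC_n(z)q^n$ lies in $\mathscr{T}_{z,q}^2$ if every $C_n(z)\in\mathscr{T}_z^2$. *)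

(* Defs.v *)
From HB Require Import structures.
From mathcomp Require Import all_boot all_order all_algebra.
From mathcomp Require Import finmap.
From mathcomp.multinomials Require Import monalg.
From mathcomp Require Import reals.

Set Implicit Arguments.
Unset Strict Implicit.
Unset Printing Implicit Defensive.

Import Order.TTheory GRing.Theory Num.Theory.

Local Open Scope fset_scope.
Local Open Scope ring_scope.

(* Laurent polynomials in z over R, i.e. the group algebra R[Z]: finitely
   supported functions int -> R.  [monalg] provides the additive group; its
   product needs an exponent monoid without nontrivial units, which excludes
   int, so the convolution product is put on the alias [laurent R]. *)
Definition laurent (R : nzRingType) := {malg R[int]}.

HB.instance Definition _ (R : nzRingType) := GRing.Zmodule.on (laurent R).

Section LaurentRing.
Variable R : comNzRingType.
Implicit Types (f g h : laurent R) (i j : int) (c : R).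

Definition lcoef f i : R := mcoeff i f.

(* the monomial c z^i *)
Definition lmon c i : laurent R := mkmalgU i c.

Definition lone : laurent R := lmon 1 0.

Definition lmul f g : laurent R :=
  \sum_(i <- msupp f) \sum_(j <- msupp g) lmon (lcoef f i * lcoef g j) (i + j).

Let lmon0 i : lmon 0 i = 0.
Proof. exact: monalgU0. Qed.

Let lmonDl c d i : lmon (c + d) i = lmon c i + lmon d i.
Proof. exact: monalgUD. Qed.

Let lmulw (d1 d2 : {fset int}) f g :
  msupp f `<=` d1 -> msupp g `<=` d2 ->
  lmul f g = \sum_(i <- d1) \sum_(j <- d2) lmon (lcoef f i * lcoef g j) (i + j).
Proof.
move=> le1 le2; rewrite /lmul (big_fset_incl _ le1) /=.
  apply: eq_bigr => i _; apply: big_fset_incl => // j _ gj.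
  by rewrite /lcoef (mcoeff_outdom gj) mulr0 lmon0.
move=> i _ fi; rewrite big1 // => j _.
by rewrite /lcoef (mcoeff_outdom fi) mul0r lmon0.
Qed.

Let lmulC : commutative lmul.
Proof.
move=> f g; rewrite /lmul exchange_big; apply: eq_bigr => i _.
by apply: eq_bigr => j _; rewrite mulrC addrC.
Qed.

Let lmul0 f : lmul 0 f = 0.
Proof. by rewrite /lmul msupp0 big_seq_fset0. Qed.

Let lmulDl : left_distributive lmul +%R.
Proof.
move=> f g h.
rewrite (lmulw (msuppD_le f g) (fsubset_refl _)).
rewrite (lmulw (fsubsetUl (msupp f) (msupp g)) (fsubset_refl (msupp h))).
rewrite (lmulw (fsubsetUr (msupp f) (msupp g)) (fsubset_refl (msupp h))).
rewrite -big_split; apply: eq_bigr => i _.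
rewrite -big_split; apply: eq_bigr => j _ /=.
by rewrite /lcoef (mcoeffD i f g) mulrDl lmonDl.
Qed.

Lemma lmon_mul c d i j : lmul (lmon c i) (lmon d j) = lmon (c * d) (i + j).
Proof.
rewrite (lmulw msuppU_le msuppU_le) !big_seq_fset1.
by rewrite /lcoef !mcoeffUU.
Qed.

Let lmul_suml (I : Type) (r : seq I) (F : I -> laurent R) g :
  lmul (\sum_(k <- r) F k) g = \sum_(k <- r) lmul (F k) g.
Proof. exact: (big_morph (lmul^~ g) (fun _ _ => lmulDl _ _ _) (lmul0 g)). Qed.

Let lmul_sumr (I : Type) (r : seq I) (F : I -> laurent R) g :
  lmul g (\sum_(k <- r) F k) = \sum_(k <- r) lmul g (F k).
Proof. by rewrite lmulC lmul_suml; apply: eq_bigr => k _; rewrite lmulC. Qed.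

Lemma laurentE f : f = \sum_(i <- msupp f) lmon (lcoef f i) i.
Proof. exact: monalgE. Qed.

Let lmulA : associative lmul.
Proof.
move=> f g h; rewrite (laurentE f) !lmul_suml; apply: eq_bigr => i _.
rewrite (laurentE g) lmul_suml !lmul_sumr lmul_suml; apply: eq_bigr => j _.
rewrite (laurentE h) !lmul_sumr; apply: eq_bigr => k _.
by rewrite !lmon_mul mulrA addrA.
Qed.

Let lmul1 : left_id lone lmul.
Proof.
move=> f; rewrite {1}(laurentE f) lmul_sumr [RHS]laurentE.
by apply: eq_bigr => i _; rewrite lmon_mul mul1r add0r.
Qed.

Let lone_neq0 : lone != 0.
Proof. by rewrite monalgU_eq0 oner_eq0. Qed.

HB.instance Definition _ := GRing.Zmodule_isComNzRing.Build (laurent R)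
  lmulA lmulC lmul1 lmulDl lone_neq0.

Lemma laurentP f g : (forall i, lcoef f i = lcoef g i) <-> f = g.
Proof. exact: malgP. Qed.

Lemma lcoef_lmon c i j : lcoef (lmon c i) j = c *+ (i == j).
Proof. exact: mcoeffU. Qed.

Lemma lmonM c d i j : lmon c i * lmon d j = lmon (c * d) (i + j).
Proof. exact: lmon_mul. Qed.

Lemma lcoefD i f g : lcoef (f + g) i = lcoef f i + lcoef g i.
Proof. exact: mcoeffD. Qed.

Lemma lcoefM i f g : lcoef (f * g) i =
  \sum_(j <- msupp f) \sum_(k <- msupp g) (lcoef f j * lcoef g k) *+ (j + k == i).
Proof.
rewrite /lcoef [LHS](raddf_sum (mcoeff i)); apply: eq_bigr => j _ /=.
by rewrite raddf_sum; apply: eq_bigr => k _; exact: mcoeffU.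
Qed.

End LaurentRing.

(* A formal power series in q over A is its sequence of coefficients. *)
Definition qseries (A : Type) := nat -> A.

Section InfiniteProduct.
Variable R : comNzRingType.

(* A multiset S of nonnegative integers is given by its multiplicities:
   S l is the number of occurrences of l.  A set is the case S l <= 1; the
   elements are positive when S 0 = 0. *)
Implicit Types S : nat -> nat.

(* (1 + z q^l) (1 + z^-1 q^l), with 'X in the role of q *)
Definition Sfactor (l : nat) : {poly laurent R} :=
  (1 + lmon 1 1 *: 'X^l) * (1 + lmon 1 (-1) *: 'X^l).

(* the subproduct over the elements of S that are < N *)
Definition Spartial S (N : nat) : {poly laurent R} :=
  \prod_(l < N) Sfactor l ^+ S l.

(* The infinite product, as the coefficientwise limit of the [Spartial S N]:
   by [Spartial_cvg] the coefficient of q^n is constant for N > n. *)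
Definition Sprod S : qseries (laurent R) := fun n => (Spartial S n.+1)`_n.

Lemma Spartial_cvg S (n N : nat) : (n < N)%N -> (Spartial S N)`_n = Sprod S n.
Proof.
elim: N => // N IHN; rewrite ltnS leq_eqVlt => /orP[/eqP -> // | ltnN].
rewrite /Spartial big_ord_recr /= -/(Spartial S N) -(IHN ltnN).
have [u ->] : exists u, Sfactor N = 1 + 'X^N * u.
  pose a : {poly laurent R} := (lmon 1 1)%:P.
  pose b : {poly laurent R} := (lmon 1 (-1))%:P.
  exists (b + a * (1 + b * 'X^N)).
  rewrite /Sfactor -!mul_polyC -/a -/b; move: a b => a b.
  rewrite [LHS]mulrDl mul1r -addrA [in RHS]mulrDr; congr (_ + (_ + _)).
    exact: mulrC.
  by rewrite [RHS]mulrCA mulrA.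
have [v ->] : exists v, (1 + 'X^N * u) ^+ S N = 1 + 'X^N * v.
  elim: (S N) => [|k [v IHk]]; first by exists 0; rewrite mulr0 addr0.
  exists (v + u * (1 + 'X^N * v)).
  by rewrite exprS IHk [LHS]mulrDl mul1r -addrA [in RHS]mulrDr mulrA.
by rewrite mulrDr mulr1 coefD mulrCA coefXnM ltnN addr0.
Qed.

(* the coefficient d_S(m, n) of z^m q^n in the infinite product *)
Definition dS S (m : int) (n : nat) : R := lcoef (Sprod S n) m.

End InfiniteProduct.

(* the sets written T_z^2 and T_{z,q}^2 *)
Definition Tz2 (R : realType) (f : laurent R) : Prop :=
  [/\ forall i : int, 0 <= lcoef f i,
      forall i : int, lcoef f (- i) = lcoef f i
    & forall r l : nat, (r < 2)%N ->
        lcoef f (r + 2 * l.+1)%N%:Z <= lcoef f (r + 2 * l)%N%:Z /\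
        (0 < lcoef f (r + 2 * l)%N%:Z ->
         lcoef f (r + 2 * l.+1)%N%:Z < lcoef f (r + 2 * l)%N%:Z)].

Definition Tzq2 (R : realType) (F : qseries (laurent R)) : Prop :=
  forall n : nat, Tz2 (F n).

(* Main.v *)
(* With a_k(f) = f_k - f_(k+2), membership in T_z^2 says that a_k(f) >= 0 for
   k >= 0, with a_k(f) > 0 as soon as f_k > 0.  For symmetric g, summation by
   parts gives
     a_m(f g) = \sum_(k >= 0) (f_(m-k) - f_(m+k+2)) a_k(g),
   and each term is nonnegative for m >= 0 because |m - k| < m + k + 2 have the
   same parity; moreover a term vanishes only if f_(m-k) g_k = 0.  Hence T_z^2
   is closed under products as well as sums, and each factor
   1 + (z + z^-1) q^l + q^(2l) has its coefficients in T_z^2. *)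
Require Import Defs.
From HB Require Import structures.
From mathcomp Require Import all_boot all_order all_algebra.
From mathcomp Require Import finmap zify ring.
From mathcomp.multinomials Require Import monalg.
From mathcomp Require Import reals.

Import Order.TTheory GRing.Theory Num.Theory.
Local Open Scope ring_scope.

(** * Coefficients of a product with a symmetric Laurent polynomial *)

Section LaurentCoef.
Context {R : comNzRingType}.
Implicit Types f g : laurent R.

Lemma lcoef0 (i : int) : lcoef (0 : laurent R) i = 0.
Proof. exact: mcoeff0. Qed.

Lemma lcoef_sum (I : Type) (r : seq I) (F : I -> laurent R) (i : int) :
  lcoef (\sum_(k <- r) F k) i = \sum_(k <- r) lcoef (F k) i.
Proof. exact: (raddf_sum (mcoeff i)). Qed.

Lemma lcoefM_lmon f c (i m : int) : lcoef (f * lmon c i) m = lcoef f (m - i) * c.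
Proof.
rewrite [in RHS](laurentE f) {1}(laurentE f) mulr_suml !lcoef_sum mulr_suml.
apply: eq_bigr => j _; rewrite lmonM !lcoef_lmon mulrnAl; congr (_ *+ _).
by rewrite -subr_eq0 -[in RHS]subr_eq0 opprB addrA.
Qed.

(** Provides the cut-off that turns the sums over all k >= 0 into finite ones. *)
Lemma lcoef_eventually0 f :
  exists N : nat, forall k : nat, (N <= k)%N -> lcoef f k%:Z = 0.
Proof.
exists (\max_(i <- msupp f) `|i|%N).+1 => k leNk; apply: mcoeff_outdom.
apply/negP => kf; move: leNk; rewrite ltnNge.
by rewrite (leq_bigmax_seq _ kf).
Qed.

(** Pairing z^k with z^-k leaves only natural indices, as summation by parts requires. *)
Lemma lcoef_symmetric_decomp g N :
  (forall i, lcoef g (- i) = lcoef g i) ->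
  (forall k : nat, (N < k)%N -> lcoef g k%:Z = 0) ->
  g = lmon (lcoef g 0) 0 + \sum_(k < N)
        (lmon (lcoef g k.+1%:Z) k.+1%:Z + lmon (lcoef g k.+1%:Z) (- k.+1%:Z)).
Proof.
move=> gN g0; apply/laurentP => j; rewrite lcoefD lcoef_sum lcoef_lmon.
have -> : lcoef g j = lcoef g `|j|%N%:Z.
  by case: (intP j) => [|n|n] //; rewrite gN abszN.
under eq_bigr do rewrite lcoefD !lcoef_lmon.
have [->|j0] := eqVneq j 0.
  by rewrite big1 ?addr0 // => k _; rewrite !mulr0n addr0.
rewrite add0r.
(* As j is nonzero, it equals at most one of k+1 and -(k+1), and does so exactly when |j| = k+1. *)
have step (k : 'I_N) : lcoef g k.+1%:Z *+ (k.+1%:Z == j) +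
    lcoef g k.+1%:Z *+ (- k.+1%:Z == j) = lcoef g k.+1%:Z *+ (k.+1 == `|j|%N).
  by rewrite -mulrnDr; congr (_ *+ _); case: (intP j) j0 => [|n|n] //; lia.
under eq_bigr do rewrite step.
have [jN|Nj] := leqP `|j|%N N.
  have jN' : (`|j|.-1 < N)%N by lia.
  rewrite (bigD1 (Ordinal jN')) //= big1 => [|k].
    by rewrite prednK ?absz_gt0 // eqxx addr0.
  by rewrite -val_eqE /= => kj; have -> : (k.+1 == `|j|%N) = false by lia.
rewrite g0 // big1 // => k _.
by have -> : (k.+1 == `|j|%N) = false by have := ltn_ord k; lia.
Qed.

Lemma lcoefM_symmetric f g N (m : int) :
  (forall i, lcoef g (- i) = lcoef g i) ->
  (forall k : nat, (N < k)%N -> lcoef g k%:Z = 0) ->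
  lcoef (f * g) m = lcoef f m * lcoef g 0 + \sum_(k < N)
     (lcoef f (m - k.+1%:Z) + lcoef f (m + k.+1%:Z)) * lcoef g k.+1%:Z.
Proof.
move=> gN g0; rewrite {1}(lcoef_symmetric_decomp _ _ gN g0) mulrDr lcoefD.
rewrite lcoefM_lmon subr0; congr (_ + _); rewrite mulr_sumr lcoef_sum.
by apply: eq_bigr => k _; rewrite mulrDr lcoefD !lcoefM_lmon opprK mulrDl.
Qed.

Lemma lcoefM_sym f g (i : int) :
  (forall i, lcoef f (- i) = lcoef f i) ->
  (forall i, lcoef g (- i) = lcoef g i) ->
  lcoef (f * g) (- i) = lcoef (f * g) i.
Proof.
move=> fN gN; have [N g0] := lcoef_eventually0 g.
have {}g0 k : (N < k)%N -> lcoef g k%:Z = 0 by move/ltnW/g0.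
rewrite !(lcoefM_symmetric _ _ _ _ gN g0) fN; congr (_ + _).
apply: eq_bigr => k _; congr (_ * _).
have -> : - i + k.+1%:Z = - (i - k.+1%:Z) by rewrite opprB addrC.
by rewrite -opprD !fN addrC.
Qed.

(** Differences of lag 2 telescope separately on even and odd indices, hence two boundary terms at
    each end. *)
Lemma summation_by_parts2 (h g : nat -> R) N :
  h 0%N * g 0%N + h 1%N * g 1%N + \sum_(k < N) (h k.+2 - h k) * g k.+2 =
  \sum_(k < N) h k * (g k - g k.+2) + (h N * g N + h N.+1 * g N.+1).
Proof.
elim: N => [|N IH]; first by rewrite !big_ord0 addr0 add0r.
rewrite !big_ord_recr /= addrA IH; ring.
Qed.

Lemma lcoefM_diff f g N (m : int) :
  (forall i, lcoef g (- i) = lcoef g i) ->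
  (forall k : nat, (N <= k)%N -> lcoef g k%:Z = 0) ->
  lcoef (f * g) m - lcoef (f * g) (m + 2) =
    \sum_(k < N) (lcoef f (m - k%:Z) - lcoef f (m + k%:Z + 2)) *
                 (lcoef g k%:Z - lcoef g k.+2%:Z).
Proof.
move=> gN g0.
(* With cut-off N+1 the symmetric expansion has N+1 terms: the first gives the boundary term in g_1,
   the other N match the terms in g_(k+2). *)
have g0' k : (N.+1 < k)%N -> lcoef g k%:Z = 0 by move=> ?; apply: g0; lia.
rewrite !(lcoefM_symmetric _ _ _ _ gN g0') !big_ord_recl /=.
have := summation_by_parts2
  (fun k => lcoef f (m - k%:Z) - lcoef f (m + k%:Z + 2)) (fun k => lcoef g k%:Z) N.
rewrite /= (g0 N) // (g0 N.+1) // !mulr0 !addr0 => <-.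
have -> : m + 2 - 1%N%:Z = m + 1%N%:Z by lia.
have -> : m + 2 + 1%N%:Z = m + 1%N%:Z + 2 by lia.
rewrite opprD addrACA opprD [X in _ + X = _]addrACA -sumrB addrA; congr (_ + _).
  by ring.
apply: eq_bigr => k _; rewrite /bump /= add1n -mulrBl; congr (_ * _).
have -> : m + 2 - k.+2%:Z = m - k%:Z by lia.
have -> : m + 2 + k.+2%:Z = m + k.+2%:Z + 2 by lia.
have -> : m + k%:Z + 2 = m + k.+2%:Z by lia.
by ring.
Qed.

End LaurentCoef.

(** * Closure properties of T_z^2 *)

Section Tz2Closure.
Context {R : realType}.
Implicit Types f g : laurent R.

Lemma Tz2_intro f :
  (forall i, 0 <= lcoef f i) -> (forall i, lcoef f (- i) = lcoef f i) ->
  (forall k : nat, lcoef f (k + 2)%N%:Z <= lcoef f k%:Z) ->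
  (forall k : nat, 0 < lcoef f k%:Z -> lcoef f (k + 2)%N%:Z < lcoef f k%:Z) ->
  Tz2 f.
Proof.
move=> f0 fN fle flt; split=> // r l _.
by rewrite mulnS addnCA addnC; split; [exact: fle | exact: flt].
Qed.

(** Remainder and quotient of k by 2 are the indices r and l of the definition. *)
Lemma Tz2_step f (k : nat) : Tz2 f ->
  lcoef f (k + 2)%N%:Z <= lcoef f k%:Z /\
  (0 < lcoef f k%:Z -> lcoef f (k + 2)%N%:Z < lcoef f k%:Z).
Proof.
case=> _ _ /(_ (k %% 2)%N (k %/ 2)%N); rewrite ltn_mod => /(_ isT).
have -> : (k %% 2 + 2 * (k %/ 2).+1 = k + 2)%N by lia.
by have -> : (k %% 2 + 2 * (k %/ 2) = k)%N by lia.
Qed.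

Lemma Tz2_le2 f (k : nat) : Tz2 f -> lcoef f (k + 2)%N%:Z <= lcoef f k%:Z.
Proof. by move/(Tz2_step _ k) => []. Qed.

Lemma Tz2_lt2 f (k : nat) :
  Tz2 f -> 0 < lcoef f k%:Z -> lcoef f (k + 2)%N%:Z < lcoef f k%:Z.
Proof. by move/(Tz2_step _ k) => []. Qed.

Lemma Tz2_abs f (i : int) : Tz2 f -> lcoef f i = lcoef f `|i|%N%:Z.
Proof. by case=> _ fN _; case: (intP i) => [|n|n] //; rewrite fN abszN. Qed.

Lemma Tz2_le f (i j : int) l :
  Tz2 f -> `|j|%N = (`|i| + l.*2)%N -> lcoef f j <= lcoef f i.
Proof.
move=> Tf; rewrite (Tz2_abs _ j Tf) (Tz2_abs _ i Tf) => ->.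
elim: l => [|l]; first by rewrite addn0.
by apply: le_trans; rewrite doubleS -addn2 addnA Tz2_le2.
Qed.

(** Of the l+1 steps of length 2 from |i| to |j|, the first is strict and the others are weak. *)
Lemma Tz2_lt f (i j : int) l :
  Tz2 f -> `|j|%N = (`|i| + l.+1.*2)%N -> 0 < lcoef f i -> lcoef f j < lcoef f i.
Proof.
move=> Tf ji; rewrite (Tz2_abs _ i Tf) => fi.
apply: le_lt_trans (Tz2_lt2 _ _ Tf fi).
by apply: (Tz2_le _ _ _ l Tf); rewrite ji absz_nat; lia.
Qed.

Lemma Tz2_0 : Tz2 (0 : laurent R).
Proof. by apply: Tz2_intro => [i|i|k|k]; rewrite !lcoef0 ?ltxx. Qed.

Lemma Tz2_1 : Tz2 (1 : laurent R).
Proof.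
have E i : lcoef (1 : laurent R) i = (i == 0)%:R.
  by rewrite [LHS](lcoef_lmon 1 0) eq_sym.
apply: Tz2_intro => [i|i|k|k]; rewrite !E ?ler0n //.
- by rewrite oppr_eq0.
- by rewrite eqz_nat addn2 ler0n.
- by rewrite !eqz_nat addn2.
Qed.

Lemma Tz2_zDzV : Tz2 (lmon 1 1 + lmon 1 (-1) : laurent R).
Proof.
have E i : lcoef (lmon 1 1 + lmon 1 (-1) : laurent R) i = (`|i|%N == 1%N)%:R.
  rewrite lcoefD !lcoef_lmon -mulrnDr; congr (_ *+ _).
  by case: (intP i) => [|[|n]|[|n]].
apply: Tz2_intro => [i|i|k|k]; rewrite !E ?ler0n ?abszN //.
- by rewrite absz_nat addn2 ler0n.
- by rewrite !absz_nat addn2 /=; case: (k == 1%N); rewrite ?ltr01 ?ltxx.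
Qed.

(** For strictness: if f_k + g_k > 0, one summand is positive and drops strictly, while the other
    drops weakly. *)
Lemma Tz2_add f g : Tz2 f -> Tz2 g -> Tz2 (f + g).
Proof.
move=> Tf Tg; have [f0 fN _] := Tf; have [g0 gN _] := Tg.
apply: Tz2_intro => [i|i|k|k]; rewrite !lcoefD.
- exact: addr_ge0.
- by rewrite fN gN.
- by apply: lerD; apply: Tz2_le2.
rewrite lt_neqAle addr_ge0 // andbT eq_sym => fgk.
have [fk|fk] := ltP 0 (lcoef f k%:Z).
  by apply: ltr_leD (Tz2_lt2 _ _ Tf fk) (Tz2_le2 _ _ Tg).
apply: ler_ltD (Tz2_le2 _ _ Tf) (Tz2_lt2 _ _ Tg _).
rewrite lt_neqAle g0 andbT eq_sym; apply: contraNneq fgk => ->.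
by rewrite addr0 eq_le fk f0.
Qed.

Lemma Tz2_sum (I : Type) (r : seq I) (F : I -> laurent R) :
  (forall k, Tz2 (F k)) -> Tz2 (\sum_(k <- r) F k).
Proof. by move=> TF; apply: big_ind => // [|f g]; [exact: Tz2_0 | exact: Tz2_add]. Qed.

Lemma Tz2_mul f g : Tz2 f -> Tz2 g -> Tz2 (f * g).
Proof.
move=> Tf Tg; have [f0 fN _] := Tf; have [g0 gN _] := Tg.
have [N gz] := lcoef_eventually0 g.
have gz' k : (N < k)%N -> lcoef g k%:Z = 0 by move/ltnW/gz.
(* The witness [minn m k] comes from m + k = |m - k| + 2 min(m, k). *)
have fle (m k : nat) : lcoef f (m%:Z + k%:Z) <= lcoef f (m%:Z - k%:Z).
  by apply: (Tz2_le _ _ _ (minn m k) Tf); lia.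
have fle2 (m k : nat) : lcoef f (m%:Z + k%:Z + 2) <= lcoef f (m%:Z - k%:Z).
  by apply: (Tz2_le _ _ _ (minn m k).+1 Tf); lia.
have gle2 (k : nat) : lcoef g k.+2%:Z <= lcoef g k%:Z.
  by rewrite -addn2 Tz2_le2.
have fg0 i : 0 <= lcoef (f * g) i.
  rewrite (lcoefM_symmetric _ _ _ _ gN gz') addr_ge0 ?mulr_ge0 //.
  by apply: sumr_ge0 => k _; rewrite mulr_ge0 ?addr_ge0.
have diff_ge0 (m k : nat) : 0 <=
    (lcoef f (m%:Z - k%:Z) - lcoef f (m%:Z + k%:Z + 2)) *
    (lcoef g k%:Z - lcoef g k.+2%:Z).
  by rewrite mulr_ge0 // subr_ge0.
have fgle2 (m : nat) : lcoef (f * g) (m + 2)%N%:Z <= lcoef (f * g) m%:Z.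
  by rewrite -subr_ge0 (lcoefM_diff _ _ _ _ gN gz) sumr_ge0.
apply: Tz2_intro => // [i|m]; first exact: lcoefM_sym.
rewrite !lt_neqAle fg0 fgle2 !andbT.
(* Contraposition: equality of the coefficients at m and m+2 is shown to force (f g)_m = 0. *)
apply: contraNN => /eqP E.
have diff0 : lcoef (f * g) m%:Z - lcoef (f * g) (m%:Z + 2) = 0.
  by rewrite -E subrr.
move: diff0; rewrite (lcoefM_diff _ _ _ _ gN gz) => /eqP.
(* A vanishing sum of nonnegative terms has only zero terms. *)
rewrite psumr_eq0 // => /allP diff0.
have fg_eq0 (k : nat) : lcoef f (m%:Z - k%:Z) * lcoef g k%:Z = 0.
  have [Nk|kN] := leqP N k; first by rewrite gz ?mulr0.
  have /(_ (mem_index_enum _)) := diff0 (Ordinal kN).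
  (* Whichever factor vanishes, strict decrease forbids the corresponding f_(m-k) or g_k from being
     positive. *)
  rewrite /= mulf_eq0 !subr_eq0 => /orP[/eqP fE|/eqP gE].
    have [fk|fk] := ltP 0 (lcoef f (m%:Z - k%:Z)).
      have : lcoef f (m%:Z + k%:Z + 2) < lcoef f (m%:Z - k%:Z).
        by apply: (Tz2_lt _ _ _ (minn m k) Tf) => //; lia.
      by rewrite fE ltxx.
    by have /eqP -> : lcoef f (m%:Z - k%:Z) == 0; rewrite ?mul0r // eq_le fk f0.
  have [gk|gk] := ltP 0 (lcoef g k%:Z).
    by have := Tz2_lt2 _ _ Tg gk; rewrite addn2 -gE ltxx.
  by have /eqP -> : lcoef g k%:Z == 0; rewrite ?mulr0 // eq_le gk g0.
(* The products f_(m-k) g_k are zero by [fg_eq0]; the products f_(m+k) g_k are squeezed between 0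
   and these by [fle]. *)
rewrite eq_sym (lcoefM_symmetric _ _ _ _ gN gz') big1 => [|k _].
  by have := fg_eq0 0%N; rewrite subr0 => ->; rewrite addr0.
apply/eqP; rewrite mulrDl fg_eq0 add0r eq_le mulr_ge0 // andbT.
by rewrite -(fg_eq0 k.+1) ler_wpM2r.
Qed.

(** * Polynomials in q with coefficients in T_z^2, for the finite subproducts *)

Definition Tzq2_poly (p : {poly laurent R}) : Prop := forall n : nat, Tz2 p`_n.

Lemma Tzq2_poly1 : Tzq2_poly 1.
Proof. by move=> n; rewrite coef1; case: eqP => _; [exact: Tz2_1 | exact: Tz2_0]. Qed.

Lemma Tzq2_poly_mul p q : Tzq2_poly p -> Tzq2_poly q -> Tzq2_poly (p * q).
Proof.
by move=> Tp Tq n; rewrite coefM; apply: Tz2_sum => k; apply: Tz2_mul.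
Qed.

Lemma Tzq2_poly_exp p k : Tzq2_poly p -> Tzq2_poly (p ^+ k).
Proof.
move=> Tp; elim: k => [|k IH]; first exact: Tzq2_poly1.
by rewrite exprS; apply: Tzq2_poly_mul.
Qed.

Lemma Tzq2_poly_Sfactor l : Tzq2_poly (Sfactor R l).
Proof.
have -> : Sfactor R l = 1 + (lmon 1 1 + lmon 1 (-1)) *: 'X^l + 'X^(l + l).
  rewrite /Sfactor mulrDl mul1r mulrDr mulr1 -scalerAl -scalerAr scalerA lmonM.
  rewrite mulr1 subrr -[lmon 1 0]/(1 : laurent R) scale1r -exprD scalerDl.
  by rewrite !addrA [1 + _ + _]addrAC.
move=> n; rewrite !coefD coefZ !coefXn; apply: Tz2_add.
  apply: Tz2_add; first exact: Tzq2_poly1.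
  by case: (n == l); rewrite ?mulr1 ?mulr0; [exact: Tz2_zDzV | exact: Tz2_0].
by case: eqP => _; [exact: Tz2_1 | exact: Tz2_0].
Qed.

End Tz2Closure.

Theorem theorem3p8 (R : realType) (S : nat -> nat) (hS : S 0%N = 0%N) :
  Tzq2 (Sprod R S) /\
  (forall m n : nat, dS R S m%:Z n != 0 ->
     dS R S (m + 2)%N%:Z n < dS R S m%:Z n).
Proof.
have T n : Tz2 (Sprod R S n).
  (* The coefficient of q^n in the infinite product is by definition that of a finite subproduct. *)
  suff: Tzq2_poly (Spartial R S n.+1) by apply.
  apply: big_ind => [|p q|l _].
  - exact: Tzq2_poly1.
  - exact: Tzq2_poly_mul.
  - exact/Tzq2_poly_exp/Tzq2_poly_Sfactor.
split=> // m n d0; apply: Tz2_lt2 (T n) _.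
(* A nonzero coefficient is positive, since membership in T_z^2 makes it nonnegative. *)
by rewrite lt_neqAle eq_sym d0; have [-> _ _] := T n.
Qed.
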